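(* Let $\lambda=(\lambda_1\ge\lambda_2\ge\dots\ge\lambda_\ell>0)$ be a partition with $\ell=\ell(\lambda)$ parts and conjugate partition $\lambda'$, and let $x_1,x_2,\dots$ and $y_1,y_2,\dots$ be commutative variables. For a corner $(r,s)$ of the Young diagram $[\lambda]$ write $$\Pi_{rs}=x_r\,y_s\prod_{i=1}^{r-1}\left(1+\frac{x_i}{x_{i+1}+\dots+x_r+y_{s+1}+\dots+y_{\lambda_i}}\right)\prod_{j=1}^{s-1}\left(1+\frac{y_j}{x_{r+1}+\dots+x_{\lambda'_j}+y_{j+1}+\dots+y_s}\right).$$ Then the following rational function identities hold, where every sum over $(r,s)$ runs over all corners $(r,s)$ of $[\lambda]$: (a) $\displaystyle\sum_{(r,s)}\Pi_{rs}=\sum_{(p,q)\in[\lambda]}x_p\,y_q$; (b) $\displaystyle\sum_{(r,s)}\frac{1}{x_{r+1}+\dots+x_{\ell}+y_1+\dots+y_s}\,\Pi_{rs}=\sum_{p=1}^{\ell}x_p$; (c) $\displaystyle\sum_{(r,s)}\frac{1}{x_1+\dots+x_r+y_{s+1}+\dots+y_{\lambda_1}}\,\Pi_{rs}=\sum_{q=1}^{\lambda_1}y_q$; (d) $\displaystyle\sum_{(r,s)}\frac{1}{(x_{r+1}+\dots+x_{\ell}+y_1+\dots+y_s)(x_1+\dots+x_r+y_{s+1}+\dots+y_{\lambda_1})}\,\Pi_{rs}=1$.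
   Context: The Young diagram of $\lambda$ is $[\lambda]=\{(i,j)\in\mathbb{Z}^2: i\ge1,\ 1\le j\le\lambda_i\}$, with the first coordinate (row) increasing downwards and the second (column) increasing to the right. The conjugate partition is $\lambda'_j=|\{i:\lambda_i\ge j\}|$. A corner of $[\lambda]$ is a square $(i,j)\in[\lambda]$ with $(i+1,j)\notin[\lambda]$ and $(i,j+1)\notin[\lambda]$. Empty sums are $0$ and empty products are $1$. *)

(* Defs.v *)
From HB Require Import structures.
From mathcomp Require Export all_boot all_order all_algebra.
From mathcomp.multinomials Require Export mpoly.

Set Implicit Arguments.
Unset Strict Implicit.
Unset Printing Implicit Defensive.

Import GRing.Theory.
Local Open Scope ring_scope.

(* A partition is the sequence of its parts; rows and columns are numbered
   from 1, as are the variables x_1, x_2, ... and y_1, y_2, ... below. *)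
Definition is_partition (lam : seq nat) : bool :=
  sorted geq lam && all (leq 1) lam.

(* part lam i = lambda_i for i >= 1, with lambda_i = 0 beyond the last part;
   part lam 0 has no meaning and never occurs. *)
Definition part (lam : seq nat) (i : nat) : nat := nth 0%N lam i.-1.

Definition conj_part (lam : seq nat) (j : nat) : nat :=
  count (fun p => j <= p)%N lam.

Definition diagram (lam : seq nat) : seq (nat * nat) :=
  [seq (i, j) | i <- iota 1 (size lam), j <- iota 1 (part lam i)].

Lemma mem_diagram (lam : seq nat) (i j : nat) :
  ((i, j) \in diagram lam) = [&& 1 <= i, 1 <= j & j <= part lam i]%N.
Proof.
apply/allpairsPdep/and3P => [[i0 [j0 []]]|[i1 j1 jle]].
  by rewrite !mem_iota => /andP[? _] /andP[? j0lt] [-> ->]; split.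
exists i, j; rewrite !mem_iota i1 j1 !add1n !ltnS jle; split=> //=.
case: leqP => // lt_i; move: jle; rewrite /part nth_default; first by case: (j) j1.
by case: (i) lt_i.
Qed.

Definition corner (lam : seq nat) (c : nat * nat) : bool :=
  [&& c \in diagram lam,
      (c.1.+1, c.2) \notin diagram lam &
      (c.1, c.2.+1) \notin diagram lam].

(* The field F(x_1, ..., x_n, y_1, ..., y_m) of rational functions. *)
Notation ratfun F n m := {fraction {mpoly F[n + m]}}.

(* x_i for 1 <= i <= n and y_j for 1 <= j <= m; values at other indices are
   irrelevant. *)
Definition xvar (F : fieldType) (n m : nat) (i : nat) : ratfun F n m :=
  if insub i.-1 is Some k then tofrac 'X_(lshift m (k : 'I_n)) else 0.

Definition yvar (F : fieldType) (n m : nat) (j : nat) : ratfun F n m :=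
  if insub j.-1 is Some k then tofrac 'X_(rshift n (k : 'I_m)) else 0.

(* z_a + ... + z_b, which is 0 when b < a. *)
Definition isum (K : fieldType) (z : nat -> K) (a b : nat) : K :=
  \sum_(a <= k < b.+1) z k.

Definition hook_prod (K : fieldType) (lam : seq nat) (x y : nat -> K)
    (r s : nat) : K :=
  x r * y s
  * \prod_(1 <= i < r)
      (1 + x i / (isum x i.+1 r + isum y s.+1 (part lam i)))
  * \prod_(1 <= j < s)
      (1 + y j / (isum x r.+1 (conj_part lam j) + isum y j.+1 s)).

(* Main.v *)
(** Delete the first row of the diagram and induct.  Writing lambda = a :: mu and
    b = mu_1, the corners (r + 1, s) of lambda with r >= 1 are the corners (r, s)
    of mu, Pi being multiplied by 1 + x_1 / A with
    A = x_2 + ... + x_(r+1) + y_(s+1) + ... + y_a, and (1, a) is a new corner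
    when b < a.  So (a) and (b) for lambda follow from (a) and (b) for mu once
    the sum of Pi / A over the corners of mu is known.  The latter is a
    deformation of (c), where a parameter z is added to all denominators at
    the cost of a correcting product over the columns; that deformation is
    itself proved by induction on rows, using partial fractions in A.  Finally
    the two denominators in (d) add up to sum x + sum y, so (d) follows from
    (b) and (c). *)
From mathcomp Require Import ring zify.
Require Import Defs.

Import GRing.Theory.
Local Open Scope ring_scope.

Set Implicit Arguments.
Unset Strict Implicit.
Unset Printing Implicit Defensive.

Arguments conj_part : simpl never.

(** * Interval sums and a telescoping product *)

Lemma isum_nil (K : fieldType) (z : nat -> K) (a b : nat) :
  (b < a)%N -> isum z a b = 0.
Proof. by move=> ba; rewrite /isum big_geq. Qed.

Lemma isum_recl (K : fieldType) (z : nat -> K) (a b : nat) :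
  (a <= b)%N -> isum z a b = z a + isum z a.+1 b.
Proof. by move=> ab; rewrite /isum big_ltn. Qed.

Lemma isum_recr (K : fieldType) (z : nat -> K) (a b : nat) :
  (a <= b.+1)%N -> isum z a b.+1 = isum z a b + z b.+1.
Proof. by move=> ab; rewrite /isum big_nat_recr. Qed.

Lemma isum_split (K : fieldType) (z : nat -> K) (c a b : nat) :
  (a <= c.+1)%N -> (c <= b)%N -> isum z a b = isum z a c + isum z c.+1 b.
Proof. by move=> ac cb; rewrite /isum (big_cat_nat (n := c.+1)). Qed.

Lemma isum_shift (K : fieldType) (z : nat -> K) (a b : nat) :
  isum (z \o S) a b = isum z a.+1 b.+1.
Proof. by rewrite /isum big_add1. Qed.

(** The factor at [j] is the ratio of [w + isum y j b] to [w + isum y j.+1 b], so consecutive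
    factors cancel; the last denominator is [w] itself. *)
Lemma prod_telescope (K : fieldType) (y : nat -> K) (w : K) (a b : nat) :
  (a <= b.+1)%N ->
  (forall j, (a <= j <= b)%N -> w + isum y j.+1 b != 0) ->
  w * \prod_(a <= j < b.+1) (1 + y j / (w + isum y j.+1 b)) = w + isum y a b.
Proof.
have [d] := ubnP (b.+1 - a)%N; elim: d a => // d IHd a lt_d ab nz.
have [ba|ba] := ltnP b a; first by rewrite big_geq // isum_nil // mulr1 addr0.
rewrite big_ltn // mulrCA IHd; try lia; last by move=> j jb; apply: nz; lia.
rewrite (isum_recl y ba).
have nza : w + isum y a.+1 b != 0 by apply: nz; rewrite leqnn.
by field.
Qed.

(** * Partitions, diagrams and corners under adding a first row *)

Lemma partition_cons (a : nat) (mu : seq nat) :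
  is_partition (a :: mu) ->
  [/\ is_partition mu, (0 < a)%N & (part mu 1 <= a)%N].
Proof.
case: mu => [|b mu] /andP[/= sorted_mu /andP[a0 mu0]]; first by split.
by case/andP: sorted_mu => ab sorted_mu; split=> //; rewrite /is_partition /= sorted_mu.
Qed.

Lemma part_le1 (mu : seq nat) (i : nat) :
  is_partition mu -> (part mu i <= part mu 1)%N.
Proof.
elim: mu i => [|b mu IHmu] i part_mu; first by rewrite /part !nth_nil.
have [part_mu' _ le_b] := partition_cons part_mu.
by case: i => [|[|i]] //; apply: leq_trans (IHmu i.+1 part_mu') le_b.
Qed.

Lemma conj_part_gt (mu : seq nat) (j : nat) :
  is_partition mu -> (part mu 1 < j)%N -> conj_part mu j = 0%N.
Proof.
elim: mu => [|b mu IHmu] //= part_mu bj.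
have [part_mu' _ le_b] := partition_cons part_mu.
rewrite /conj_part /= -/(conj_part mu j) leqNgt bj; apply: IHmu => //.
exact: leq_ltn_trans le_b bj.
Qed.

Lemma conj_part_cons (a : nat) (mu : seq nat) (j : nat) :
  (j <= a)%N -> conj_part (a :: mu) j = (conj_part mu j).+1.
Proof. by rewrite /conj_part /= => ->. Qed.

Lemma diagram_bounds (mu : seq nat) (c : nat * nat) :
  is_partition mu -> c \in diagram mu ->
  [/\ (0 < c.1)%N, (c.1 <= size mu)%N, (0 < c.2)%N & (c.2 <= part mu 1)%N].
Proof.
case: c => r s part_mu; rewrite mem_diagram => /and3P[r0 s0 sle]; split=> //=.
  rewrite leqNgt; apply/negP=> rgt; move: sle.
  by rewrite /part nth_default; lia.
exact: leq_trans sle (part_le1 _ part_mu).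
Qed.

Lemma diagram_cons (a : nat) (mu : seq nat) :
  diagram (a :: mu) = [seq (1%N, j) | j <- iota 1 a]
                       ++ [seq (c.1.+1, c.2) | c <- diagram mu].
Proof.
rewrite /diagram /= map_allpairs; congr (_ ++ _).
rewrite (iotaDl 1 1) /= allpairs_mapl.
(* [part (a :: mu) i.+1] agrees with [part mu i] only for [i >= 1], because [part] takes a
   predecessor; positivity of the row indices is therefore carried along. *)
have : all (leq 1) (iota 1 (size mu)) by apply/allP=> i; rewrite mem_iota; lia.
by elim: (iota 1 _) => //= -[|i] s IHs // /IHs ->.
Qed.

Lemma corner_cons (a : nat) (mu : seq nat) (r s : nat) :
  (0 < r)%N -> corner (a :: mu) (r.+1, s) = corner mu (r, s).
Proof. by case: r => // r _; rewrite /corner /= !mem_diagram. Qed.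

Lemma corner_row1 (a : nat) (mu : seq nat) (s : nat) :
  (0 < s)%N -> (part mu 1 <= a)%N ->
  corner (a :: mu) (1%N, s) = (s == a) && (part mu 1 < a)%N.
Proof.
move=> s0 mua; rewrite /corner /= !mem_diagram /= s0 /=.
rewrite (_ : part (a :: mu) 2 = part mu 1) // /part /=; lia.
Qed.

Lemma sum_corner_cons (V : nmodType) (a : nat) (mu : seq nat)
    (f : nat * nat -> V) :
  is_partition (a :: mu) ->
  \sum_(c <- diagram (a :: mu) | corner (a :: mu) c) f c
  = (if (part mu 1 < a)%N then f (1%N, a) else 0)
    + \sum_(c <- diagram mu | corner mu c) f (c.1.+1, c.2).
Proof.
move=> part_lam; have [part_mu a0 mua] := partition_cons part_lam.
rewrite diagram_cons big_cat !big_map /=; congr (_ + _); last first.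
  rewrite big_seq_cond [RHS]big_seq_cond; apply: eq_bigl => -[r s].
  case: (boolP (_ \in _)) => //= /(diagram_bounds part_mu)[/= r0 _ _ _].
  exact: corner_cons.
rewrite big_seq_cond.
rewrite (eq_bigl (fun j => (j \in iota 1 a) && ((j == a) && (part mu 1 < a)%N))).
  rewrite -big_seq_cond; case: ifP => _.
    rewrite (eq_bigl (pred1 a)); last by move=> j; rewrite andbT.
    by rewrite -big_filter filter_pred1_uniq ?iota_uniq ?big_seq1 // mem_iota; lia.
  by rewrite big_pred0 // => j; rewrite andbF.
move=> j; case: (boolP (_ \in _)) => //=; rewrite mem_iota => /andP[j0 _].
exact: corner_row1.
Qed.

(** * Hook products under adding a first row *)

(** Only the row factor [i = 1] is new. The other row factors are reindexed, and each column
    [j < s <= a] gains one cell, which just shifts its sum of x-variables. *)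
Lemma hook_prod_cons (K : fieldType) (a : nat) (mu : seq nat) (x y : nat -> K)
    (r s : nat) :
  (0 < r)%N -> (s <= a)%N ->
  hook_prod (a :: mu) x y r.+1 s
  = hook_prod mu (x \o S) y r s
    * (1 + x 1%N / (isum x 2 r.+1 + isum y s.+1 a)).
Proof.
move=> r0 sa; rewrite /hook_prod big_ltn // big_add1 /=.
set U := \prod_(1 <= j < r) _; set V := \prod_(1 <= j < r) _.
have -> : U = V.
  apply: eq_big_nat => i /andP[i0 _]; rewrite !isum_shift.
  by congr (1 + _ / (_ + isum _ _ _)); case: i i0.
set W := \prod_(1 <= j < s) _; set W' := \prod_(1 <= j < s) _.
have -> : W = W'; last by rewrite /part /=; ring.
apply: eq_big_nat => j /andP[j0 js].
by rewrite conj_part_cons ?isum_shift //; lia.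
Qed.

(* The product over columns in [hook_prod] at the square (0, lambda_1 + 1), for
   a row of length lambda_1 + 1 added on top, with y_(lambda_1 + 1) = z. *)
Definition col_prod (K : fieldType) (lam : seq nat) (x y : nat -> K) (z : K) :=
  \prod_(1 <= j < (part lam 1).+1)
    (1 + y j / (z + isum y j.+1 (part lam 1) + isum x 1 (conj_part lam j))).

(** The columns of [mu] give the product for [mu] with parameter [w]. Each later column has a single
    cell, and these factors telescope from [z + x 1] to [w]. *)
Lemma col_prod_cons (K : fieldType) (a : nat) (mu : seq nat) (x y : nat -> K)
    (z : K) (w := z + x 1%N + isum y (part mu 1).+1 a) :
  is_partition (a :: mu) ->
  (forall j, (j <= a)%N -> z + x 1%N + isum y j.+1 a != 0) ->
  (z + x 1%N) * col_prod (a :: mu) x y z = w * col_prod mu (x \o S) y w.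
Proof.
move=> /partition_cons[part_mu a0 mua] nz.
rewrite /col_prod (big_cat_nat (n := (part mu 1).+1)) //=.
rewrite mulrCA [RHS]mulrC; congr (_ * _).
  apply: eq_big_nat => j /andP[j0 jb]; congr (1 + _ / _).
  rewrite conj_part_cons ?isum_shift; last lia.
  rewrite (@isum_recl _ x 1) //.
  by rewrite (@isum_split _ _ (part mu 1) _ a) /w //; ring.
rewrite /w -prod_telescope // => [|j jb]; last by apply: nz; lia.
congr (_ * _); apply: eq_big_nat => j /andP[jb ja].
rewrite conj_part_cons ?conj_part_gt //.
by rewrite (@isum_recl _ x 1) // (@isum_nil _ x 2) // addr0 addrAC.
Qed.

(** The columns beyond [mu] telescope from [y a] to [w]. If [(1, a)] is not a corner then [w] is an
    empty sum, so the right-hand side covers both cases. *)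
Lemma hook_prod_row1 (K : fieldType) (a : nat) (mu : seq nat) (x y : nat -> K)
    (w := isum y (part mu 1).+1 a) :
  is_partition (a :: mu) ->
  (forall j, (j < a)%N -> isum y j.+1 a != 0) ->
  (if (part mu 1 < a)%N then hook_prod (a :: mu) x y 1 a else 0)
  = x 1%N * (w * col_prod mu (x \o S) y w).
Proof.
move=> /partition_cons[part_mu a0 mua] nz.
case: ifP => [ba|ba]; last by rewrite /w isum_nil ?mul0r ?mulr0 //; lia.
rewrite /hook_prod [\prod_(1 <= i < 1) _]big_geq // mulr1 -mulrA; congr (_ * _).
rewrite (big_cat_nat (n := (part mu 1).+1)) //= mulrCA [RHS]mulrC.
congr (_ * _).
  apply: eq_big_nat => j /andP[j0 jb]; congr (1 + _ / _).
  rewrite conj_part_cons ?isum_shift; last lia.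
  by rewrite (@isum_split _ _ (part mu 1) _ a) /w //; ring.
(* Writing the row length as [a.+1] isolates [y a.+1], the starting value of the telescoping
   product. *)
case: a a0 mua nz @w ba => // a _ mua nz w ba.
have recr j : (j <= a)%N -> y a.+1 + isum y j.+1 a = isum y j.+1 a.+1.
  by move=> ja; rewrite addrC -isum_recr.
rewrite /w -recr // -prod_telescope // => [|j jb]; last by rewrite recr ?nz //; lia.
congr (_ * _); apply: eq_big_nat => j /andP[jb ja].
rewrite conj_part_cons ?conj_part_gt //; last lia.
by rewrite (@isum_nil _ x 2) // add0r recr.
Qed.

(** * Nonvanishing denominators and the deformation of (c) *)

(* All denominators occurring in the identities are sums of this form. *)
Definition generic (K : fieldType) (l m : nat) (x y : nat -> K) :=
  forall r r' s s', (1 <= r <= r'.+1)%N -> (r' <= l)%N ->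
    (1 <= s <= s'.+1)%N -> (s' <= m)%N -> (r <= r')%N || (s <= s')%N ->
  isum x r r' + isum y s s' != 0.

Lemma generic_shift (K : fieldType) (l m m' : nat) (x y : nat -> K) :
  (m' <= m)%N -> generic l.+1 m x y -> generic l m' (x \o S) y.
Proof.
move=> mm gen r r' s s' *; rewrite isum_shift; apply: gen; lia.
Qed.

Lemma generic_y (K : fieldType) (l m : nat) (x y : nat -> K) (s s' : nat) :
  generic l m x y -> (1 <= s <= s')%N -> (s' <= m)%N -> isum y s s' != 0.
Proof.
move=> gen ss sm; have := gen 1%N 0%N s s'.
by rewrite (@isum_nil _ x) // add0r; apply=> //; lia.
Qed.

(* Partial fractions reduce the case [a :: mu] to the case [mu] with [z]
   replaced by [w] and by [z + x 1 + w]. *)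
Lemma sum_corner_inv (K : fieldType) (lam : seq nat) (x y : nat -> K) (z : K) :
  is_partition lam -> generic (size lam) (part lam 1) x y ->
  (forall r s, (r <= size lam)%N -> (s <= part lam 1)%N ->
     (0 < r)%N || (s < part lam 1)%N ->
     z + isum x 1 r + isum y s.+1 (part lam 1) != 0) ->
  \sum_(c <- diagram lam | corner lam c)
     hook_prod lam x y c.1 c.2 / (z + isum x 1 c.1 + isum y c.2.+1 (part lam 1))
  = z + isum y 1 (part lam 1) - z * col_prod lam x y z.
Proof.
elim: lam x z => [|a mu IHmu] x z part_lam gen nz.
  by rewrite /col_prod /= big_nil big_geq // isum_nil //; ring.
have [part_mu a0 mua] := partition_cons part_lam.
have gen_mu := generic_shift mua gen.
rewrite sum_corner_cons //=; change (part (a :: mu) 1) with a in gen, nz |- *.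
set b := part mu 1 in mua gen_mu *.
pose w := isum y b.+1 a; pose x' := x \o S.
have splitA r s : (s <= b)%N ->
    isum x 2 r.+1 + isum y s.+1 a = w + isum x' 1 r + isum y s.+1 b.
  by move=> sb; rewrite isum_shift (@isum_split _ _ b _ a) /w //; ring.
have nz1 r s : (r <= size mu)%N -> (s <= b)%N -> (0 < r)%N || (s < b)%N ->
    w + isum x' 1 r + isum y s.+1 b != 0.
  by move=> rl sb rs; rewrite -splitA //; apply: gen => //=; lia.
have nz2 r s : (r <= size mu)%N -> (s <= b)%N -> (0 < r)%N || (s < b)%N ->
    z + x 1%N + w + isum x' 1 r + isum y s.+1 b != 0.
  move=> rl sb rs; have -> : z + x 1%N + w + isum x' 1 r + isum y s.+1 b
            = z + isum x 1 r.+1 + isum y s.+1 a.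
    by rewrite (@isum_recl _ x 1 r.+1) // -addrA -addrA [w + _]addrA -splitA //; ring.
  by apply: nz => //=; lia.
have nzx : z + x 1%N != 0.
  have := nz 1%N a isT (leqnn a) isT.
  by rewrite isum_recl // !isum_nil // !addr0.
have -> : (if (b < a)%N then
    hook_prod (a :: mu) x y 1 a / (z + isum x 1 1 + isum y a.+1 a) else 0)
    = x 1%N * (w * col_prod mu x' y w) / (z + x 1%N).
  rewrite -hook_prod_row1 // => [|j ja]; last by apply: (generic_y gen).
  by case: ifP => _; rewrite ?mul0r // isum_recl // !isum_nil // !addr0.
(* With A the denominator from the first row, (1 + x_1/A)/(z + x_1 + A) = (x_1/A + z/(z + x_1 +
   A))/(z + x_1). *)
have -> : \sum_(c <- diagram mu | corner mu c)
      hook_prod (a :: mu) x y c.1.+1 c.2 / (z + isum x 1 c.1.+1 + isum y c.2.+1 a)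
    = (x 1%N * (\sum_(c <- diagram mu | corner mu c)
         hook_prod mu x' y c.1 c.2 / (w + isum x' 1 c.1 + isum y c.2.+1 b))
       + z * (\sum_(c <- diagram mu | corner mu c)
         hook_prod mu x' y c.1 c.2
           / (z + x 1%N + w + isum x' 1 c.1 + isum y c.2.+1 b))) / (z + x 1%N).
  rewrite !mulr_sumr -big_split /= mulr_suml.
  rewrite big_seq_cond [RHS]big_seq_cond; apply: eq_bigr => -[r s].
  case/andP=> /(diagram_bounds part_mu)[/= r0 rl s0 sb] _.
  rewrite hook_prod_cons //; last exact: leq_trans mua.
  have nzA : isum x 2 r.+1 + isum y s.+1 a != 0 by apply: gen => //=; lia.
  have nzB : z + isum x 1 r.+1 + isum y s.+1 a != 0 by apply: nz => //=; lia.
  move: nzA nzB; rewrite (@isum_recl _ x 1 r.+1) //.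
  have -> : z + x 1%N + w + isum x' 1 r + isum y s.+1 b
          = z + x 1%N + (w + isum x' 1 r + isum y s.+1 b) by ring.
  have -> : z + (x 1%N + isum x 2 r.+1) + isum y s.+1 a
          = z + x 1%N + (isum x 2 r.+1 + isum y s.+1 a) by ring.
  rewrite -splitA //; move: (isum x 2 r.+1 + _) (hook_prod _ _ _ _ _) => A P.
  by move=> nzA nzB; field; rewrite nzx nzB nzA.
(* The correcting term of the first sum cancels the contribution of [(1, a)]; that of the second
   becomes the one for [a :: mu] by [col_prod_cons]. *)
rewrite (IHmu _ _ part_mu gen_mu nz1) (IHmu _ _ part_mu gen_mu nz2).
have := @col_prod_cons K a mu x y z part_lam.
rewrite -/b -/w -/x' => /(_ _)/(canRL (mulKf nzx)) ->; last first.
  move=> j ja; have := nz 1%N j isT ja isT.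
  by rewrite isum_recl // (@isum_nil _ x 2) // addr0.
rewrite (@isum_split _ _ b _ a) // -/w.
by field.
Qed.

(** The guard excludes [r = 0], [s = part lam 1], where both sums are empty; this makes [z = 0]
    admissible in [sum_corner_inv]. *)
Lemma generic_inv (K : fieldType) (lam : seq nat) (x y : nat -> K) (r s : nat) :
  generic (size lam) (part lam 1) x y ->
  (r <= size lam)%N -> (s <= part lam 1)%N -> (0 < r)%N || (s < part lam 1)%N ->
  0 + isum x 1 r + isum y s.+1 (part lam 1) != 0.
Proof. by move=> gen *; rewrite add0r; apply: gen => //; lia. Qed.

(** * The four identities for generic values in a field *)

(** Identity (c) is the deformation at [z = 0], where the correcting term vanishes. *)
Lemma sum_corner_y (K : fieldType) (lam : seq nat) (x y : nat -> K) :
  is_partition lam -> generic (size lam) (part lam 1) x y ->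
  \sum_(c <- diagram lam | corner lam c)
     1 / (isum x 1 c.1 + isum y c.2.+1 (part lam 1)) * hook_prod lam x y c.1 c.2
  = isum y 1 (part lam 1).
Proof.
move=> part_lam gen.
have := @sum_corner_inv K lam x y 0 part_lam gen (fun r s => generic_inv gen).
rewrite mul0r subr0 add0r => <-; apply: eq_bigr => c _.
by rewrite add0r mul1r mulrC.
Qed.

(** The first-row denominator is [w] plus the denominator of (c) for [mu], so this is the
    deformation at [z = w]. By [hook_prod_row1], [x 1] times the correcting term is the hook product
    of the corner [(1, a)], hence the two cancel in (a) and (b). *)
Lemma sum_corner_inv_row1 (K : fieldType) (a : nat) (mu : seq nat)
    (x y : nat -> K) (w := isum y (part mu 1).+1 a) (x' := x \o S) :
  is_partition (a :: mu) -> generic (size mu).+1 a x y ->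
  \sum_(c <- diagram mu | corner mu c)
     hook_prod mu x' y c.1 c.2 / (isum x 2 c.1.+1 + isum y c.2.+1 a)
  = isum y 1 a - w * col_prod mu x' y w.
Proof.
move=> part_lam gen; have [part_mu a0 mua] := partition_cons part_lam.
have splitA r s : (s <= part mu 1)%N ->
    isum x 2 r.+1 + isum y s.+1 a = w + isum x' 1 r + isum y s.+1 (part mu 1).
  move=> sb; rewrite isum_shift (@isum_split _ _ (part mu 1) _ a) /w //.
  by ring.
rewrite (@isum_split _ _ (part mu 1) _ a) // [isum y 1 _ + _]addrC.
rewrite -sum_corner_inv // => [||r s rl sb rs].
- rewrite big_seq_cond [RHS]big_seq_cond; apply: eq_bigr => -[r s].
  case/andP=> /(diagram_bounds part_mu)[/= r0 rl s0 sb] _.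
  by rewrite splitA.
- exact: generic_shift gen.
- by rewrite -splitA //; apply: gen => //=; lia.
Qed.

Lemma sum_corner_x (K : fieldType) (lam : seq nat) (x y : nat -> K) :
  is_partition lam -> generic (size lam) (part lam 1) x y ->
  \sum_(c <- diagram lam | corner lam c)
     1 / (isum x c.1.+1 (size lam) + isum y 1 c.2) * hook_prod lam x y c.1 c.2
  = isum x 1 (size lam).
Proof.
elim: lam x => [|a mu IHmu] x part_lam gen; first by rewrite big_nil isum_nil.
have [part_mu a0 mua] := partition_cons part_lam.
have gen_mu := generic_shift mua gen.
rewrite sum_corner_cons //=; change (part (a :: mu) 1) with a in gen.
pose w := isum y (part mu 1).+1 a; pose x' := x \o S.
pose T := isum x 2 (size mu).+1 + isum y 1 a.
have nzT : T != 0 by apply: gen => //=; lia.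
have -> : (if (part mu 1 < a)%N then
    1 / (isum x 2 (size mu).+1 + isum y 1 a) * hook_prod (a :: mu) x y 1 a else 0)
    = x 1%N * (w * col_prod mu x' y w) / T.
  rewrite -hook_prod_row1 // => [|j ja]; last by apply: (generic_y gen).
  by case: ifP => _; rewrite ?mul0r // mul1r mulrC.
(* If B is the denominator of (b), then A + B = T does not depend on the corner, and (1 + x_1/A)/B =
   ((T + x_1)/T)/B + (x_1/T)/A. *)
have -> : \sum_(c <- diagram mu | corner mu c)
      1 / (isum x c.1.+2 (size mu).+1 + isum y 1 c.2)
        * hook_prod (a :: mu) x y c.1.+1 c.2
    = (T + x 1%N) / T * (\sum_(c <- diagram mu | corner mu c)
         1 / (isum x' c.1.+1 (size mu) + isum y 1 c.2) * hook_prod mu x' y c.1 c.2)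
      + x 1%N / T * (\sum_(c <- diagram mu | corner mu c)
         hook_prod mu x' y c.1 c.2 / (isum x 2 c.1.+1 + isum y c.2.+1 a)).
  rewrite !mulr_sumr -big_split /=.
  rewrite big_seq_cond [RHS]big_seq_cond; apply: eq_bigr => -[r s].
  case/andP=> /(diagram_bounds part_mu)[/= r0 rl s0 sb] _.
  rewrite hook_prod_cons //; last exact: leq_trans mua.
  have nzA : isum x 2 r.+1 + isum y s.+1 a != 0 by apply: gen => //=; lia.
  have nzB : isum x r.+2 (size mu).+1 + isum y 1 s != 0 by apply: gen => //=; lia.
  have TE : T = (isum x 2 r.+1 + isum y s.+1 a)
              + (isum x r.+2 (size mu).+1 + isum y 1 s).
    rewrite /T (@isum_split _ _ r.+1 _ (size mu).+1) //.
    by rewrite (@isum_split _ _ s _ a) //; [ring | exact: leq_trans mua].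
  move: nzT; rewrite TE isum_shift.
  move: nzA nzB; move: (isum x 2 r.+1 + _) (isum x r.+2 _ + _) => A B.
  by move: (hook_prod _ _ _ _ _) => P nzA nzB nzT; field; rewrite nzT nzB nzA.
(* After cancellation of the [col_prod] terms, the coefficient of [x 1 / T] is
   [isum x 2 (size mu).+1 + isum y 1 a], which is T. *)
rewrite (IHmu _ part_mu gen_mu) sum_corner_inv_row1 // -/w -/x' isum_shift.
rewrite (@isum_recl _ x 1) //; move: nzT; rewrite /T => nzT.
by field.
Qed.

(** Once the corner [(1, a)] cancels the correcting term, the first row contributes
    [x 1 * isum y 1 a], its share of the sum over the diagram. *)
Lemma sum_corner_xy (K : fieldType) (lam : seq nat) (x y : nat -> K) :
  is_partition lam -> generic (size lam) (part lam 1) x y ->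
  \sum_(c <- diagram lam | corner lam c) hook_prod lam x y c.1 c.2
  = \sum_(c <- diagram lam) x c.1 * y c.2.
Proof.
elim: lam x => [|a mu IHmu] x part_lam gen; first by rewrite !big_nil.
have [part_mu a0 mua] := partition_cons part_lam.
have gen_mu := generic_shift mua gen.
rewrite sum_corner_cons //=; change (part (a :: mu) 1) with a in gen.
rewrite hook_prod_row1 // => [|j ja]; last by apply: (generic_y gen).
have -> : \sum_(c <- diagram mu | corner mu c) hook_prod (a :: mu) x y c.1.+1 c.2
    = \sum_(c <- diagram mu | corner mu c) hook_prod mu (x \o S) y c.1 c.2
      + x 1%N * (\sum_(c <- diagram mu | corner mu c)
         hook_prod mu (x \o S) y c.1 c.2 / (isum x 2 c.1.+1 + isum y c.2.+1 a)).
  rewrite mulr_sumr -big_split /=.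
  rewrite big_seq_cond [RHS]big_seq_cond; apply: eq_bigr => -[r s].
  case/andP=> /(diagram_bounds part_mu)[/= r0 rl s0 sb] _.
  by rewrite hook_prod_cons //; [ring | exact: leq_trans mua].
rewrite (IHmu _ part_mu gen_mu) sum_corner_inv_row1 //.
rewrite diagram_cons big_cat !big_map /= -mulr_sumr.
rewrite (_ : \sum_(j <- iota 1 a) y j = isum y 1 a); first by ring.
by rewrite /isum /index_iota subn1.
Qed.

(** Multiplied by T = A + B, the weight 1/(A B) becomes 1/A + 1/B. For the empty partition the sum
    is 0, hence the hypothesis [lam != [::]]. *)
Lemma sum_corner_1 (K : fieldType) (lam : seq nat) (x y : nat -> K) :
  is_partition lam -> generic (size lam) (part lam 1) x y -> lam != [::] ->
  \sum_(c <- diagram lam | corner lam c)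
     1 / ((isum x c.1.+1 (size lam) + isum y 1 c.2)
          * (isum x 1 c.1 + isum y c.2.+1 (part lam 1)))
     * hook_prod lam x y c.1 c.2
  = 1.
Proof.
move=> part_lam gen lam0.
have l0 : (0 < size lam)%N by case: lam lam0 {part_lam gen}.
set T := isum x 1 (size lam) + isum y 1 (part lam 1).
have nzT : T != 0 by apply: gen => //; lia.
apply: (mulfI nzT); rewrite mulr1 {2}/T.
rewrite -{1}(sum_corner_x part_lam gen) -(sum_corner_y part_lam gen).
rewrite -big_split mulr_sumr /=.
rewrite big_seq_cond [RHS]big_seq_cond; apply: eq_bigr => -[r s].
case/andP=> /(diagram_bounds part_lam)[/= r0 rl s0 sb] _.
have nzA : isum x 1 r + isum y s.+1 (part lam 1) != 0 by apply: gen => //; lia.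
have nzB : isum x r.+1 (size lam) + isum y 1 s != 0 by apply: gen => //; lia.
have -> : T = (isum x 1 r + isum y s.+1 (part lam 1))
            + (isum x r.+1 (size lam) + isum y 1 s).
  rewrite /T (@isum_split _ _ r _ (size lam)) //.
  by rewrite (@isum_split _ _ s _ (part lam 1)) //; ring.
by field; rewrite nzA nzB.
Qed.

(** * Genericity of the variables in the rational function field *)

(** By injectivity of [k] on [s], the variable of the first index has coefficient 1 in the
    polynomial sum. *)
Lemma tofrac_sum_neq0 (F : fieldType) (N : nat) (I : eqType) (s : seq I)
    (k : I -> 'I_N) (z : I -> {fraction {mpoly F[N]}}) :
  uniq s -> {in s &, injective k} -> s != [::] ->
  {in s, forall i, z i = tofrac 'X_(k i)} ->
  \sum_(i <- s) z i != 0.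
Proof.
case: s => // i0 s uniq_s inj_k _ zE.
rewrite big_seq (eq_bigr (fun i => tofrac 'X_(k i))) => [|i si]; last exact: zE.
rewrite -big_seq -rmorph_sum tofrac_eq0; apply/eqP => /(congr1 (mcoeff U_(k i0))).
rewrite mcoeff0 raddf_sum big_cons /= mcoeffXU eqxx big_seq big1 => [|i si].
  by move/eqP; rewrite addr0 oner_eq0.
rewrite mcoeffXU; case: eqP => // ki; move: uniq_s => /= /andP[/negP[]].
by rewrite -(inj_k i i0) // ?mem_head // in_cons si orbT.
Qed.

Lemma generic_vars (F : fieldType) (n m l l' : nat) :
  (l <= n)%N -> (l' <= m)%N -> generic l l' (xvar F n m) (yvar F n m).
Proof.
move=> ln lm r r' s s' /andP[r0 rr] rl /andP[s0 ss] sl ne.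
(* Tagged indices merge the x-sum and the y-sum into one; [v] is the zero-based position among the
   [n + m] variables. *)
pose v (c : nat + nat) := match c with inl i => i.-1 | inr j => (n + j.-1)%N end.
pose t := [seq inl i | i <- index_iota r r'.+1]
            ++ [seq inr j | j <- index_iota s s'.+1] : seq (nat + nat).
have nm_gt0 : (0 < n + m)%N by lia.
(* The default ordinal is never reached on [t], by [vlt]. *)
pose k c := insubd (Ordinal nm_gt0) (v c).
have mem_l i : (inl i \in t) = (r <= i <= r')%N.
  by rewrite mem_cat mem_map ?mem_index_iota ?ltnS;
    [case: mapP => [[]|] //; rewrite orbF | move=> ? ? []].
have mem_r j : (inr j \in t) = (s <= j <= s')%N.
  by rewrite mem_cat orbC mem_map ?mem_index_iota ?ltnS;
    [case: mapP => [[]|] //; rewrite orbF | move=> ? ? []].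
have vlt c : c \in t -> (v c < n + m)%N.
  by case: c => i; rewrite ?mem_l ?mem_r /=; lia.
have kE c : c \in t -> k c = v c :> nat.
  by move=> /vlt lt; rewrite /k val_insubd lt.
pose z c := match c with inl i => xvar F n m i | inr j => yvar F n m j end.
have -> : isum (xvar F n m) r r' + isum (yvar F n m) s s' = \sum_(c <- t) z c.
  by rewrite big_cat !big_map.
apply: (tofrac_sum_neq0 (k := k)) => [|c d ct dt /(congr1 val)||c ct].
- rewrite cat_uniq !map_inj_uniq ?iota_uniq ?andbT /=; try by move=> ? ? [].
  by apply/hasPn => _ /mapP[j _ ->]; apply/mapP => -[].
- rewrite /= !kE //; case: c d ct dt => i [] j; rewrite ?mem_l ?mem_r /= => *;
    try congr (_ _); lia.
- by apply/eqP => t0; have := mem_l r; have := mem_r s; rewrite t0 !in_nil; lia.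
- have := kE c ct; case: c ct => i; rewrite ?mem_l ?mem_r /= /xvar /yvar => ib kEi.
    case: insubP => [u _ uE|]; last lia.
    by congr (tofrac 'X_ _); apply: val_inj; rewrite /= uE kEi.
  case: insubP => [u _ uE|]; last lia.
  by congr (tofrac 'X_ _); apply: val_inj; rewrite /= uE kEi.
Qed.

Theorem theorem3p1 (F : fieldType) (lam : seq nat) (n m : nat)
    (lam_part : is_partition lam)
    (le_n : (size lam <= n)%N) (le_m : (part lam 1 <= m)%N) :
  let l := size lam in
  let x := xvar F n m in
  let y := yvar F n m in
  let Pi := hook_prod lam x y in
  [/\ \sum_(c <- diagram lam | corner lam c) Pi c.1 c.2
        = \sum_(c <- diagram lam) x c.1 * y c.2,
      \sum_(c <- diagram lam | corner lam c)
          1 / (isum x c.1.+1 l + isum y 1 c.2) * Pi c.1 c.2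
        = \sum_(1 <= p < l.+1) x p,
      \sum_(c <- diagram lam | corner lam c)
          1 / (isum x 1 c.1 + isum y c.2.+1 (part lam 1)) * Pi c.1 c.2
        = \sum_(1 <= q < (part lam 1).+1) y q
    & lam != [::] ->
      \sum_(c <- diagram lam | corner lam c)
          1 / ((isum x c.1.+1 l + isum y 1 c.2)
               * (isum x 1 c.1 + isum y c.2.+1 (part lam 1))) * Pi c.1 c.2
        = 1].
Proof.
move=> l x y Pi.
have gen : generic (size lam) (part lam 1) x y by apply: generic_vars.
split=> [|||lam0].
- exact: sum_corner_xy.
- exact: sum_corner_x.
- exact: sum_corner_y.
- exact: sum_corner_1.
Qed.
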